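(* Let $n\ge1$. For any integer $K\ge1$ and any $\alpha>0$ there exist closed convex proper functions $f,g:\mathbb{R}^n\to\mathbb{R}\cup\{+\infty\}$ and a $\frac1\alpha$-smooth convex function $h:\mathbb{R}^n\to\mathbb{R}$, for which there are $x^\star,u^\star\in\mathbb{R}^n$ with $0\in\partial f(x^\star)+\nabla h(x^\star)+u^\star$ and $0\in\partial g^*(u^\star)-x^\star$, and points $x^0,u^0\in\mathbb{R}^n$, $x\in\mathrm{dom}\, f$, $u\in\mathrm{dom}\, g^*$ such that $\|x^0-x\|^2+\alpha^2\|u^0-u\|^2=1$ and $$\mathcal{L}(\bar x^K,u)-\mathcal{L}(x,\bar u^K)=\frac{1}{\alpha(K+1)}\left(\|x^0-x\|^2+\alpha^2\|u^0-u\|^2\right),$$ where $\bar x^K=\frac1K\sum_{k=1}^K x^k$, $\bar u^K=\frac1K\sum_{k=1}^K u^k$, and $\{(x^k,u^k)\}_{k\ge0}$ is generated from $(x^0,u^0)$ by $$x^{k+1}=\mathrm{prox}_{\alpha f}\big(x^k-\alpha(u^k+\nabla h(x^k))\big),\qquad u^{k+1}=\mathrm{prox}_{\alpha^{-1}g^*}\Big(u^k+\tfrac1\alpha\big(2x^{k+1}-x^k+\alpha\nabla h(x^k)-\alpha\nabla h(x^{k+1})\big)\Big),\qquad k=0,1,2,\dots$$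
   Context: $\langle\cdot,\cdot\rangle$ and $\|\cdot\|$ are the standard inner product and Euclidean norm on $\mathbb{R}^n$. $h$ is $L$-smooth if it is differentiable with $L$-Lipschitz gradient. $g^*(y)=\sup_x\{\langle y,x\rangle-g(x)\}$ is the Fenchel conjugate, $\partial$ the convex subdifferential, and $\mathrm{prox}_\varphi(x)=\arg\min_{y}\{\varphi(y)+\frac12\|y-x\|^2\}$. The Lagrangian is $\mathcal{L}(x,u)=f(x)+h(x)+\langle u,x\rangle-g^*(u)$. The iteration is the swapped Davis--Yin splitting algorithm (variant DYS-$fg$) for minimizing $f+g+h$. *)

(* Defs.v *)
From mathcomp Require Import all_boot all_order all_algebra.
From mathcomp Require Import all_classical all_reals all_analysis.

Set Implicit Arguments.
Unset Strict Implicit.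
Unset Printing Implicit Defensive.

Import Order.TTheory GRing.Theory Num.Theory.
Import numFieldNormedType.Exports.

Local Open Scope classical_set_scope.
Local Open Scope ring_scope.

Section Defs.
Context {R : realType} {n : nat}.
Implicit Types (x y u v p : 'rV[R]_n) (f g : 'rV[R]_n -> \bar R)
  (h : 'rV[R]_n -> R).

Definition dotp x y : R := \sum_(i < n) x 0 i * y 0 i.

(* The library norm of a matrix is the sup norm, hence this definition. *)
Definition enorm x : R := Num.sqrt (dotp x x).

Definition dom f : set 'rV[R]_n := [set x | (f x < +oo)%E].

(* R^o is R as a module over itself, so that the product is an R-module. *)
Definition epigraph f : set ('rV[R]_n * R^o) :=
  [set z | (f z.1 <= (z.2 : R)%:E)%E].

Definition proper f : Prop :=
  (forall x, f x != -oo%E) /\ (exists x, dom f x).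

Definition closed_convex_proper f : Prop :=
  [/\ closed (epigraph f), convex_set (epigraph f) & proper f].

Definition grad h x : 'rV[R]_n := \row_(i < n) 'D_(delta_mx 0 i) h x.

Definition smooth (L : R) h : Prop :=
  (forall x, differentiable h x) /\
  (forall x y, enorm (grad h x - grad h y) <= L * enorm (x - y)).

(* Intended for functions that never take the value -oo. *)
Definition fenchel_conj g : 'rV[R]_n -> \bar R :=
  fun y => ereal_sup [set ((dotp y x)%:E - g x)%E | x in [set: 'rV[R]_n]].

(* For proper f, this set is empty when f x = +oo. *)
Definition subdifferential f x : set 'rV[R]_n :=
  [set v | forall y, (f x + (dotp v (y - x))%:E <= f y)%E].

Definition argmin f : set 'rV[R]_n := [set p | forall y, (f p <= f y)%E].

(* The set of minimizers: "p is the proximal point of f at x" is stated as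
   prox f x = [set p], which asserts existence and uniqueness. *)
Definition prox f x : set 'rV[R]_n :=
  argmin (fun y => (f y + (2^-1 * enorm (y - x) ^+ 2)%:E)%E).

Definition lagrangian f g h x u : \bar R :=
  (f x + (h x)%:E + (dotp u x)%:E - fenchel_conj g u)%E.

Definition dys_fg (a : R) f g h (xs us : nat -> 'rV[R]_n) : Prop :=
  forall k : nat,
    prox (fun y => (a%:E * f y)%E) (xs k - a *: (us k + grad h (xs k)))
      = [set xs k.+1] /\
    prox (fun y => (a^-1%:E * fenchel_conj g y)%E)
         (us k + a^-1 *: (2 *: xs k.+1 - xs k + a *: grad h (xs k)
                            - a *: grad h (xs k.+1)))
      = [set us k.+1].

(* Average of the terms of index 1 to K; the initial point is excluded. *)
Definition ergodic (K : nat) (zs : nat -> 'rV[R]_n) : 'rV[R]_n :=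
  K%:R^-1 *: \sum_(1 <= k < K.+1) zs k.

End Defs.

(* Main.v *)
Require Import Defs.
From mathcomp Require Import all_boot all_order all_algebra.
From mathcomp Require Import all_classical all_reals all_analysis.
From mathcomp Require Import ring lra.

Import Order.TTheory GRing.Theory Num.Theory.
Import numFieldNormedType.Exports.

Local Open Scope classical_set_scope.
Local Open Scope ring_scope.

(** The bound is attained already with h = 0 and g = 0. Then the conjugate of g
    is the indicator of the origin, so u^k = 0 for k >= 1 ([prox_conj0]), and the
    algorithm is the proximal point method for f, except that its first step
    starts from x^0 - a u^0 rather than from x^0. Among all (x^0, u^0) with
    |x^0|^2 + a^2 |u^0|^2 = 1, the point x^0 - a u^0 is farthest from the
    origin, at distance sqrt 2, when - a u^0 = x^0; hence this choice.

    With x = 0 and u = 0 the gap is f(xbar^K) - f(0). Take f to be c times the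
    absolute value of one coordinate. Each proximal step then moves the iterate
    by s = a c towards 0 ([prox_abs_coord]), so that after k <= sqrt 2 / s steps
    it lies at distance sqrt 2 - k s. While no iterate up to K has passed the
    origin, averaging gives
      f(xbar^K) = c (sqrt 2 - (K + 1) s / 2),
    which is largest for s = sqrt 2 / (K + 1). For this slope the origin is
    reached at step K + 1 exactly, x^k lies K + 1 - k steps away from it, the
    average is sqrt 2 / 2 ([sum_countdown]), and the gap is 1 / (a (K + 1)). *)

Lemma dotp_ge0 {R : realType} {n : nat} (x : 'rV[R]_n) : 0 <= dotp x x.
Proof. by apply: sumr_ge0 => i _; rewrite -expr2 sqr_ge0. Qed.

Lemma dotp0l {R : realType} {n : nat} (x : 'rV[R]_n) : dotp 0 x = 0.
Proof. by rewrite /dotp big1 // => i _; rewrite mxE mul0r. Qed.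

Lemma dotpZr {R : realType} {n : nat} (c : R) (x y : 'rV[R]_n) :
  dotp x (c *: y) = c * dotp x y.
Proof. by rewrite /dotp mulr_sumr; apply: eq_bigr => i _; rewrite mxE; ring. Qed.

Lemma dotp_eq0 {R : realType} {n : nat} (x : 'rV[R]_n) :
  (dotp x x == 0) = (x == 0).
Proof.
apply/eqP/eqP => [/eqP|->]; last exact: dotp0l.
rewrite psumr_eq0 => [/allP x0|i _]; last by rewrite -expr2 sqr_ge0.
apply/rowP => i; apply/eqP; rewrite mxE -sqrf_eq0 expr2.
exact: (x0 i (mem_index_enum i)).
Qed.

Lemma enorm_sqr {R : realType} {n : nat} (x : 'rV[R]_n) :
  enorm x ^+ 2 = dotp x x.
Proof. by rewrite sqr_sqrtr // dotp_ge0. Qed.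

Lemma enorm_sqrZ {R : realType} {n : nat} (c : R) (x : 'rV[R]_n) :
  enorm (c *: x) ^+ 2 = c ^+ 2 * enorm x ^+ 2.
Proof.
by rewrite !enorm_sqr /dotp mulr_sumr; apply: eq_bigr => i _; rewrite mxE; ring.
Qed.

Lemma enorm_sqr_delta {R : realType} {n : nat} (i : 'I_n) :
  enorm (delta_mx 0 i : 'rV[R]_n) ^+ 2 = 1.
Proof.
rewrite enorm_sqr /dotp (bigD1 i) //= big1 => [|j /negbTE ji].
  by rewrite mxE !eqxx mulr1 addr0.
by rewrite mxE ji andbF mulr0.
Qed.

(** Expanding both squares, the second order terms in y cancel; this turns the
    three-point inequality into an inequality linear in y. *)
Lemma enorm_sqrB_delta {R : realType} {n : nat} (i : 'I_n) (t : R)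
    (y : 'rV[R]_n) :
  enorm (y - t *: delta_mx 0 i) ^+ 2 = enorm y ^+ 2 - 2 * t * y 0 i + t ^+ 2.
Proof.
rewrite !enorm_sqr /dotp (bigD1 i) //= [in RHS](bigD1 i) //=.
rewrite (eq_bigr (fun j => y 0 j * y 0 j)) => [|j /negbTE ji].
  by rewrite !mxE !eqxx /=; ring.
by rewrite !mxE ji andbF mulr0 subr0.
Qed.

(** The quadratic term in y - p on the left makes p a minimizer and, being
    positive away from p, also rules out any second one. Keeping f extended-real
    valued lets indicator functions be treated in the same way. *)
Lemma prox_three_point {R : realType} {n : nat} (f : 'rV[R]_n -> \bar R)
    (z p : 'rV[R]_n) :
  f p \is a fin_num ->
  (forall y, (f p + (2^-1 * enorm (p - z) ^+ 2 + 2^-1 * enorm (y - p) ^+ 2)%:E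
              <= f y + (2^-1 * enorm (y - z) ^+ 2)%:E)%E) ->
  prox f z = [set p].
Proof.
move=> fp H; apply/seteqP; split => [q /(_ p) qp|_ -> y].
  have := le_trans (H q) qp; rewrite -(fineK fp) -!EFinD lee_fin => qp0.
  have /eqP : enorm (q - p) ^+ 2 = 0.
    by apply/eqP; rewrite eq_le sqr_ge0 andbT; lra.
  by rewrite enorm_sqr dotp_eq0 subr_eq0 => /eqP.
apply: le_trans (H y); rewrite leeD2l // lee_fin lerDl.
by rewrite mulr_ge0 ?sqr_ge0 // invr_ge0.
Qed.

(** Soft thresholding: a proximal step on a multiple of the absolute value of one
    coordinate moves a point of the nonnegative half-axis by the constant length
    s towards the origin, and stops there. *)
Lemma prox_abs_coord {R : realType} {n : nat} (i : 'I_n) (s t : R) :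
  0 <= s -> 0 <= t ->
  prox (fun y : 'rV[R]_n => (s * `|y 0 i|)%:E) (t *: delta_mx 0 i)
    = [set Num.max 0 (t - s) *: delta_mx 0 i].
Proof.
move=> s0 t0; apply: prox_three_point => // y.
set p := Num.max 0 (t - s).
have p0 : 0 <= p by rewrite /p le_max lexx.
rewrite -!EFinD lee_fin -scalerBl enorm_sqrZ !enorm_sqrB_delta enorm_sqr_delta.
rewrite !mxE !eqxx !mulr1 (ger0_norm p0).
(* What remains of the three-point inequality. Either p = t - s, so that the
   left-hand side vanishes, or p = 0 and t <= s. *)
suff : p * (s - (t - p)) <= s * `|y 0 i| - (t - p) * y 0 i by lra.
have yn := ler_norm (y 0 i).
have n0 := normr_ge0 (y 0 i).
rewrite /p; case: (leP (t - s) 0) => ts; nra.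
Qed.

Lemma closed_convex_proper_EFin {R : realType} {n : nat}
    (phi : 'rV[R]_n -> R) :
  continuous phi -> convex_function [set: 'rV[R]_n] phi ->
  closed_convex_proper (fun x => (phi x)%:E).
Proof.
move=> cphi xphi; split.
- have -> : epigraph (fun x => (phi x)%:E) =
      (fun z : 'rV[R]_n * R^o => (z.2 : R) - phi z.1) @^-1` [set t | 0 <= t].
    by apply/seteqP; split => z; rewrite /epigraph /= lee_fin subr_ge0.
  apply: preimage_closed; last exact: closed_ge.
  move=> z _; apply: (@continuousB R _ _ snd (phi \o fst)).
    exact: cvg_snd.
  by apply: continuous_comp; [exact: cvg_fst|exact: cphi].
- move=> z w t; rewrite !inE /epigraph /= !lee_fin => zphi wphi.
  apply: le_trans (xphi t z.1 w.1 _ _) _; rewrite ?inE //.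
  apply: (lerD (ler_wpM2l _ zphi) (ler_wpM2l _ wphi)) => /=.
    exact: ge0.
  by rewrite subr_ge0 le1.
- by split => //; exists 0; rewrite /dom /= ltry.
Qed.

Lemma convex_abs_coord {R : realType} {n : nat} (i : 'I_n) (c : R) :
  0 <= c -> convex_function [set: 'rV[R]_n] (fun x => c * `|x 0 i|).
Proof.
move=> c0 t x y _ _; rewrite convRE /= /unstable.onem.
have -> : t%:num * (c * `|x 0 i|) + (1 - t%:num) * (c * `|y 0 i|)
    = c * (`|t%:num * x 0 i| + `|(1 - t%:num) * y 0 i|).
  rewrite !normrM (@ger0_norm _ t%:num) ?ge0 //.
  by rewrite (@ger0_norm _ (1 - t%:num)) ?subr_ge0 ?le1 //; ring.
by apply: ler_wpM2l => //; rewrite !mxE; exact: ler_normD.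
Qed.

Lemma continuous_abs_coord {R : realType} {n : nat} (i : 'I_n) (c : R) :
  continuous (fun x : 'rV[R]_n => c * `|x 0 i|).
Proof.
have cx : continuous (fun x : 'rV[R]_n => `|x 0 i|).
  move=> x; apply: continuous_comp; first exact: coord_continuous.
  exact: norm_continuous.
move=> x; exact: (continuous_comp (cx x) (@mulrl_continuous R c _)).
Qed.

Lemma fenchel_conj0 {R : realType} {n : nat} (y : 'rV[R]_n) :
  fenchel_conj (fun=> 0%E) y = if y == 0 then 0%E else +oo%E.
Proof.
case: eqP => [->|/eqP y0].
  apply/eqP; rewrite eq_le; apply/andP; split.
    by apply: ub_ereal_sup => _ [x _ <-]; rewrite dotp0l sube0.
  by apply: ereal_sup_ubound; exists 0 => //; rewrite dotp0l sube0.
(* The linear form with coefficient vector y takes the value r at this multiple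
   of y. *)
apply/eqyP => r _; apply: ereal_sup_ubound; exists ((r / dotp y y) *: y) => //.
by rewrite dotpZr divfK ?dotp_eq0 // sube0.
Qed.

(** The conjugate of 0 is the indicator of the origin, so the dual iterate
    returns to 0 after one step, whatever the argument of the proximal map. *)
Lemma prox_conj0 {R : realType} {n : nat} (c : R) (z : 'rV[R]_n) : 0 < c ->
  prox (fun y => (c%:E * fenchel_conj (fun=> 0%E) y)%E) z = [set 0].
Proof.
move=> c0; apply: prox_three_point => [|y]; rewrite !fenchel_conj0 eqxx mule0 //.
have [->|_] := eqVneq y 0; last by rewrite gt0_muley ?lte_fin // leey.
by rewrite mule0 subrr (enorm_sqr 0) dotp0l mulr0 addr0.
Qed.

Lemma grad0 {R : realType} {n : nat} (x : 'rV[R]_n) : grad (fun=> 0) x = 0.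
Proof. by apply/rowP => i; rewrite !mxE; exact: derive_cst. Qed.

(** The K iterates after the starting point lie K, ..., 1 steps away from the
    minimizer; this is the sum of those distances in units of the step length. *)
Lemma sum_countdown {R : realType} (K : nat) :
  \sum_(1 <= k < K.+1) (K.+1 - k)%:R = K%:R * (K%:R + 1) / 2 :> R.
Proof.
have -> : \sum_(1 <= k < K.+1) (K.+1 - k)%:R = \sum_(1 <= k < K.+1) k%:R :> R.
  rewrite big_nat_rev; apply: eq_big_nat => k /andP[_ kK].
  by rewrite add1n subSS subKn // ltnW.
elim: K => [|K IH]; first by rewrite big_geq // !mul0r.
by rewrite big_nat_recr //= IH -natr1; field.
Qed.

Theorem corollary4p6 (R : realType) (n : nat) (hn : (1 <= n)%N)
    (K : nat) (hK : (1 <= K)%N) (a : R) (ha : 0 < a) :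
  exists (f g : 'rV[R]_n -> \bar R) (h : 'rV[R]_n -> R),
    [/\ closed_convex_proper f,
        closed_convex_proper g,
        convex_function [set: 'rV[R]_n] h,
        smooth a^-1 h &
        (exists xstar ustar : 'rV[R]_n,
           [set v + grad h xstar + ustar | v in subdifferential f xstar] 0 /\
           [set w - xstar | w in subdifferential (fenchel_conj g) ustar] 0) /\
        (exists (x0 u0 x u : 'rV[R]_n) (xs us : nat -> 'rV[R]_n),
           [/\ dom f x,
               dom (fenchel_conj g) u,
               enorm (x0 - x) ^+ 2 + a ^+ 2 * enorm (u0 - u) ^+ 2 = 1,
               [/\ xs 0%N = x0, us 0%N = u0 & dys_fg a f g h xs us] &
               (lagrangian f g h (ergodic K xs) u
                  - lagrangian f g h x (ergodic K us)
                = ((a * (K%:R + 1))^-1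
                     * (enorm (x0 - x) ^+ 2
                          + a ^+ 2 * enorm (u0 - u) ^+ 2))%:E)%E])].
Proof.
pose i : 'I_n := Ordinal hn.
pose e : 'rV[R]_n := delta_mx 0 i.
pose d : R := Num.sqrt 2.
pose s : R := d / (K%:R + 1).
pose f (x : 'rV[R]_n) : \bar R := (s / a * `|x 0 i|)%:E.
(* Truncated subtraction: the iterates stay at the origin after step K + 1. *)
pose xs k : 'rV[R]_n :=
  if k is 0%N then (d / 2) *: e else (s * (K.+1 - k)%:R) *: e.
pose us k : 'rV[R]_n := if k is 0%N then - (d / (2 * a)) *: e else 0.
have d0 : 0 <= d by exact: sqrtr_ge0.
have d2 : d ^+ 2 = 2 by exact: sqr_sqrtr.
have K0 : 0 < K%:R :> R by rewrite ltr0n.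
have s0 : 0 <= s by rewrite divr_ge0 // addr_ge0 // ltW.
have a0 : a != 0 by rewrite gt_eqF.
have c0 : 0 <= s / a by rewrite divr_ge0 // ltW.
have e1 : enorm e ^+ 2 = 1 by exact: enorm_sqr_delta.
have dist1 : enorm (xs 0%N - 0) ^+ 2 + a ^+ 2 * enorm (us 0%N - 0) ^+ 2 = 1.
  rewrite !subr0 /= !enorm_sqrZ e1 sqrrN !expr_div_n exprMn d2; field.
  by rewrite a0.
have prox_f k : prox (fun y => (a%:E * f y)%E) ((s * (K.+1 - k)%:R) *: e)
    = [set xs k.+1].
  have -> : (fun y => (a%:E * f y)%E) = (fun y => (s * `|y 0 i|)%:E).
    by apply/funext => y; rewrite /f -EFinM; congr (_%:E); field.
  rewrite prox_abs_coord ?mulr_ge0 //= subnS -/e.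
  case: (K.+1 - k)%N => [|m] /=; congr [set _ *: _].
    by rewrite mulr0 sub0r max_l // oppr_le0.
  by rewrite -natr1 mulrDr mulr1 addrK max_r // mulr_ge0.
exists f, (fun=> 0%E), (fun=> 0); split.
- apply: closed_convex_proper_EFin; first exact: continuous_abs_coord.
  exact: convex_abs_coord.
- apply: (@closed_convex_proper_EFin R n (fun=> 0)).
    exact: cst_continuous.
  by move=> t x y _ _; rewrite convRE !mulr0 addr0.
- by move=> t x y _ _; rewrite convRE !mulr0 addr0.
- split=> [x|x y]; first exact: differentiable_cst.
  by rewrite !grad0 subrr {1}/enorm dotp0l sqrtr0 mulr_ge0 ?sqrtr_ge0 //
     invr_ge0 ltW.
split.
  exists 0, 0; split; exists 0; rewrite ?grad0 ?addr0 ?subr0 //.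
    move=> y; rewrite dotp0l adde0 lee_fin mxE normr0 mulr0.
    by rewrite mulr_ge0.
  move=> y; rewrite dotp0l adde0 !fenchel_conj0 eqxx.
  by case: ifP => _; rewrite ?leey.
exists (xs 0%N), (us 0%N), 0, 0, xs, us; split => //.
- by rewrite /dom /= ltry.
- by rewrite /dom /= fenchel_conj0 eqxx ltry.
- split => // k; split; last by rewrite prox_conj0 // invr_gt0.
  rewrite grad0 addr0 -(prox_f k); congr prox.
  case: k => [|k] /=; last by rewrite scaler0 subr0.
  (* The first step starts from x^0 - a u^0 = sqrt 2 e = (K + 1) s e. *)
  rewrite scalerA -scalerBl subn0 -natr1 /s; congr (_ *: _); field.
  by rewrite a0 /= gt_eqF // addr_gt0.
- rewrite dist1 mulr1.
  have -> : ergodic K us = 0.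
    by rewrite /ergodic big_nat_cond big1 ?scaler0 // => -[].
  have -> : ergodic K xs = (d / 2) *: e.
    rewrite /ergodic (eq_big_nat _ _ (F2 := fun k => (s * (K.+1 - k)%:R) *: e)) => [|[]//].
    rewrite -scaler_suml -mulr_sumr sum_countdown scalerA; congr (_ *: _).
    by rewrite /s; field; rewrite !gt_eqF // addr_gt0.
  rewrite /lagrangian fenchel_conj0 eqxx !dotp0l !adde0 !sube0 -EFinB /f.
  rewrite !mxE !eqxx mulr1 normr0 mulr0 subr0 ger0_norm ?divr_ge0 //.
  congr (_%:E); rewrite /s.
  have -> : d / (K%:R + 1) / a * (d / 2) = d ^+ 2 / 2 / (K%:R + 1) / a.
    by field; rewrite a0 gt_eqF // addr_gt0.
  by rewrite d2; field; rewrite a0 gt_eqF // addr_gt0.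
Qed.
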